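(* Suppose $\Gamma$ is a transmission regular digraph of order $n$ with transmission $t$ and $\operatorname{spec}(\mathcal{D}(\Gamma))=\{t=\partial_1,\ \partial_2^{(m)},\ 0^{(n-1-m)}\}$. Define $\Gamma_\ell=\Gamma\,\Box\cdots\Box\,\Gamma$, the Cartesian product of $\ell$ copies of $\Gamma$. Then the order of $\Gamma_\ell$ is $n^\ell$ and $$\operatorname{spec}(\mathcal{D}(\Gamma_\ell))=\{\ell t\,n^{\ell-1},\ (\partial_2\,n^{\ell-1})^{(m\ell)},\ 0^{(n^\ell-1-m\ell)}\}.$$
   Context: A digraph $\Gamma$ has a finite vertex set $V(\Gamma)=\{v_1,\dots,v_n\}$ and a set $E(\Gamma)$ of ordered pairs of distinct vertices (arcs); $n$ is its order. A digraph of order at least two is strongly connected if for every pair of vertices $u,v$ there is a dipath from $u$ to $v$. For strongly connected $\Gamma$, $d(u,v)$ is the length of a shortest dipath from $u$ to $v$, the distance matrix $\mathcal{D}(\Gamma)$ has $(i,j)$ entry $d(v_i,v_j)$, and the transmission of $v_i$ is $\sum_j d(v_i,v_j)$. A strongly connected digraph is transmission regular with transmission $t$ if every vertex has transmission $t$. The Cartesian product $\Gamma\,\Box\,\Gamma'$ has vertex set $V(\Gamma)\times V(\Gamma')$ and an arc from $(x,x')$ to $(y,y')$ iff ($x'=y'$ and $(x,y)\in E(\Gamma)$) or ($x=y$ and $(x',y')\in E(\Gamma')$); it is associative. $\operatorname{spec}(A)$ is the multiset of complex eigenvalues of $A$ with algebraic multiplicity; $x^{(m)}$ means $x$ is listed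 $m$ times. $\ell$ is a positive integer. *)

(* Defs.v *)
From mathcomp Require Import all_boot all_order all_algebra.

Set Implicit Arguments.
Unset Strict Implicit.
Unset Printing Implicit Defensive.

Import GRing.Theory.
Local Open Scope ring_scope.

Record digraph := Digraph {
  vertex :> finType;
  arc : rel vertex;
  arc_irr : irreflexive arc
}.

Section Distance.
Variable G : digraph.
Implicit Types u v : G.

Definition order_of : nat := #|G|.

(* [u :: p] is the vertex list of a dipath, whose length is [size p]; vertices
   do not repeat, and the empty [p] is the dipath of length 0 from u to u. *)
Definition dipath u v (p : seq G) : bool :=
  [&& path (@arc G) u p, last u p == v & uniq (u :: p)].

Definition strongly_connected : Prop :=
  (2 <= order_of)%N /\ forall u v, exists p, dipath u v p.

(* Dipaths do not repeat vertices, so lengths below #|G| suffice; the value is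
   the meaningless #|G| when there is no dipath from u to v. *)
Definition dist u v : nat :=
  find (fun k => [exists p : k.-tuple G, dipath u v p]) (iota 0 #|G|).

Definition transmission u : nat := (\sum_(v : G) dist u v)%N.

Definition transmission_regular (t : nat) : Prop :=
  strongly_connected /\ forall u, transmission u = t.

(* The vertices are listed in the order of [enum G]. *)
Definition dist_mx (C : numClosedFieldType) : 'M[C]_#|G| :=
  \matrix_(i, j) (dist (enum_val i) (enum_val j))%:R.

End Distance.

Definition cart_arc (G H : digraph) : rel (G * H) := fun x y =>
  ((x.2 == y.2) && arc x.1 y.1) || ((x.1 == y.1) && arc x.2 y.2).

Lemma cart_arc_irr (G H : digraph) : irreflexive (@cart_arc G H).
Proof. by move=> x; rewrite /cart_arc !arc_irr !andbF. Qed.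

Definition cart_prod (G H : digraph) : digraph := Digraph (@cart_arc_irr G H).

Lemma no_arc_irr : irreflexive (fun _ _ : unit => false).
Proof. by []. Qed.

Definition K1 : digraph := Digraph no_arc_irr.

(* [iterop] makes this the product of exactly l copies of G, associated to the
   right, when l > 0; the value K1 is used only for l = 0. *)
Definition cart_power (G : digraph) (l : nat) : digraph :=
  iterop l cart_prod G K1.

(* The eigenvalues with algebraic multiplicity: the roots of the characteristic
   polynomial, as a list that is meaningful only up to [perm_eq]. *)
Definition spec (C : numClosedFieldType) (n : nat) (A : 'M[C]_n) : seq C :=
  sval (closed_field_poly_normal (char_poly A)).

(* Ensures that [spec A] lists all the roots with multiplicity. *)
Lemma char_poly_spec (C : numClosedFieldType) (n : nat) (A : 'M[C]_n) :
  char_poly A = \prod_(x <- spec A) ('X - x%:P).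
Proof.
rewrite /spec; case: closed_field_poly_normal => s /= {1}->.
by rewrite (monicP (char_poly_monic A)) scale1r.
Qed.

(* Main.v *)
Require Import Defs.
From mathcomp Require Import all_boot all_order all_algebra.
From mathcomp Require Import zify ring.

(** Why the theorem holds.  A walk in a Cartesian product splits into a walk in
    each factor, the lengths adding up, so the distance in the product is the
    sum of the distances in the factors ([dist_cart_prod]).  Write A and B for
    the distance matrices of G and H, of orders n and n' and transmissions t and
    t'.  That of the product is then A tensor J + J tensor B, J being all-ones.

    This nn' x nn' matrix factors through dimension n + n': it is XY, where the
    row of X indexed by (x, y) marks the vertex x of G and the vertex y of H, and
    the rows of Y list the distances from each vertex of G or H.  Up to a power
    of the indeterminate, XY and YX have the same characteristic polynomial, and
    YX = [n' A, t J; t' J, n B] is small enough to handle: the two constant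
    off-diagonal blocks contribute rank 2.

    Transmission regularity makes the all-ones vectors eigenvectors of the
    diagonal blocks, for n' t and n t'.  On their span YX acts as the 2 x 2 matrix
    [n' t, n' t; n t', n t'], with eigenvalues 0 and n' t + n t'; on the quotient
    the coupling is invisible.  So the coupling only replaces the eigenvalues
    n' t and n t' by n' t + n t' and 0.  Both comparisons, that of XY with YX and
    this one, are instances of one determinant identity ([det_rank_update]).

    The result ([spec_cart_prod]) is an equality of multisets, and the theorem
    follows from it by induction on the number of factors, by counting each
    eigenvalue: an added factor scales the old eigenvalues d2 n^(l-1) by n and
    brings m copies of d2, scaled by n^l to the same value; all other eigenvalues
    are 0, except the transmission. *)

Set Implicit Arguments.
Unset Strict Implicit.
Unset Printing Implicit Defensive.

Import GRing.Theory.
Local Open Scope ring_scope.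

(** * Distances in Cartesian products *)

Lemma uniq_size_lt (G : digraph) (u : G) (p : seq G) :
  uniq (u :: p) -> (size p < #|G|)%N.
Proof.
by move=> uniq_p; have := max_card [in u :: p]; rewrite (card_uniqP uniq_p).
Qed.

(** The distance is defined through vertex-simple dipaths; removing the loops of
    an arbitrary walk shows that walks, which are easier to combine, bound it
    just as well. *)
Lemma dist_le_walk (G : digraph) (u : G) (p : seq G) :
  path (@Defs.arc G) u p -> (dist u (last u p) <= size p)%N.
Proof.
case/shortenP=> q pathq uniq_q sub_qp.
apply: leq_trans (uniq_leq_size (subseq_uniq (subseq_cons q u) uniq_q) sub_qp).
rewrite leqNgt; apply/negP => /(before_find 0%N).
rewrite nth_iota ?(uniq_size_lt uniq_q) // add0n => /existsP[].
by exists (in_tuple q); rewrite /dipath /= pathq eqxx.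
Qed.

Lemma dist_walk (G : digraph) (u v : G) : strongly_connected G ->
  exists p, [/\ path (@Defs.arc G) u p, last u p = v & size p = dist u v].
Proof.
case=> _ /(_ u v)[q dipath_q].
have ltq : (size q < #|G|)%N by case/and3P: dipath_q => _ _ /uniq_size_lt.
set a := fun k => [exists p : k.-tuple G, dipath u v p].
have has_a : has a (iota 0 #|G|).
  apply/hasP; exists (size q); first by rewrite mem_iota.
  by apply/existsP; exists (in_tuple q).
have := nth_find 0%N has_a.
rewrite has_find size_iota in has_a.
rewrite nth_iota // add0n => /existsP[p /and3P[pathp /eqP lastp _]].
by exists p; rewrite size_tuple.
Qed.

(** Walk through the first coordinate, then through the second. *)
Lemma walk_cart_prod (G H : digraph) (x x' : G) (y y' : H) p q :
    path (@Defs.arc G) x p -> last x p = x' ->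
    path (@Defs.arc H) y q -> last y q = y' ->
  exists2 r : seq (cart_prod G H), path (@Defs.arc (cart_prod G H)) (x, y) r
    & last (x, y) r = (x', y') /\ size r = (size p + size q)%N.
Proof.
move=> pathp <- pathq <- {x' y'}.
exists ([seq (z, y) | z <- p] ++ [seq (last x p, z) | z <- q]); last first.
  by rewrite last_cat (last_map (fun z => (z, y))) (last_map (pair _))
             size_cat !size_map.
rewrite cat_path (last_map (fun z => (z, y))); apply/andP; split.
  elim: p x pathp => //= z p IHp x /andP[xz pathp].
  by rewrite IHp // /cart_arc /= eqxx xz.
elim: q y pathq => //= z q IHq y /andP[yz pathq].
by rewrite IHq // /cart_arc /= eqxx yz orbT.
Qed.

(** Each arc of the product moves exactly one coordinate, so each step of a walk
    is counted in exactly one of the two projections. *)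
Lemma walk_of_cart_prod (G H : digraph) (x : G) (y : H)
    (r : seq (cart_prod G H)) :
    path (@Defs.arc (cart_prod G H)) (x, y) r ->
  exists p q, [/\ path (@Defs.arc G) x p, path (@Defs.arc H) y q,
    last (x, y) r = (last x p, last y q) & size r = (size p + size q)%N].
Proof.
elim: r x y => [|[x1 y1] r IHr] x y /=; first by exists [::], [::].
case/andP=> step /IHr[p [q [pathp pathq -> ->]]].
case/orP: step => /= /andP[/eqP ? step]; subst.
  by exists (x1 :: p), q; rewrite /= step pathp; split.
by exists p, (y1 :: q); rewrite /= step pathq addnS; split.
Qed.

Lemma order_cart_prod (G H : digraph) :
  order_of (cart_prod G H) = (order_of G * order_of H)%N.
Proof. exact: card_prod. Qed.

Lemma strongly_connected_cart_prod (G H : digraph) :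
  strongly_connected G -> strongly_connected H ->
  strongly_connected (cart_prod G H).
Proof.
move=> scG scH; split=> [|[x y] [x' y']].
  by rewrite order_cart_prod; case: scG scH => leG _ [leH _]; nia.
have [p [pathp lastp _]] := dist_walk x x' scG.
have [q [pathq lastq _]] := dist_walk y y' scH.
have [r /shortenP[r' pathr uniqr _] [lastr _]] :=
  walk_cart_prod pathp lastp pathq lastq.
by exists r'; rewrite /dipath pathr lastr eqxx.
Qed.

Lemma dist_cart_prod (G H : digraph) (u v : cart_prod G H) :
  strongly_connected G -> strongly_connected H ->
  dist u v = (dist u.1 v.1 + dist u.2 v.2)%N.
Proof.
case: u v => [x y] [x' y'] scG scH /=; apply/eqP; rewrite eqn_leq.
apply/andP; split.
  have [p [pathp lastp <-]] := dist_walk x x' scG.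
  have [q [pathq lastq <-]] := dist_walk y y' scH.
  have [r pathr [<- <-]] := walk_cart_prod pathp lastp pathq lastq.
  exact: dist_le_walk.
have scGH := strongly_connected_cart_prod scG scH.
have [r [/walk_of_cart_prod[p [q [pathp pathq -> ->]]]]] :=
  @dist_walk (cart_prod G H) (x, y) (x', y') scGH.
by case=> <- <- <-; apply: leq_add; apply: dist_le_walk.
Qed.

Lemma transmission_regular_cart_prod (G H : digraph) t t' :
  transmission_regular G t -> transmission_regular H t' ->
  transmission_regular (cart_prod G H) (order_of H * t + order_of G * t').
Proof.
move=> [scG trG] [scH trH]; split; first exact: strongly_connected_cart_prod.
move=> u; rewrite /transmission; under eq_bigr do rewrite dist_cart_prod //.
rewrite -(pair_bigA _ (fun x y => dist u.1 x + dist u.2 y)%N) /=.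
under eq_bigr do rewrite big_split /= sum_nat_const.
rewrite big_split /= sum_nat_const -big_distrr /=.
by rewrite -(trG u.1) -(trH u.2).
Qed.

(** * Determinants and characteristic polynomials *)

(** If the columns of U span an A-invariant space on which A acts by S, then
    A + UV acts on that space by S + VU and induces the same map as A on the
    quotient.  The identity says this without division, hence over every
    commutative ring: it is the determinant of
    [1, -V; U, A] [S, 0; -U, 1] = [S + VU, -V; 0, A]. *)
Lemma det_rank_update (R : comPzRingType) p q (A : 'M[R]_p) (S : 'M_q)
    (U : 'M_(p, q)) (V : 'M_(q, p)) :
  A *m U = U *m S ->
  \det S * \det (A + U *m V) = \det (S + V *m U) * \det A.
Proof.
move=> AU.
have detK : \det (block_mx 1%:M (- V) U A) = \det (A + U *m V).
  have -> : block_mx 1%:M (- V) U A =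
      block_mx 1%:M 0 U 1%:M *m block_mx 1%:M (- V) 0 (A + U *m V).
    by rewrite mulmx_block !mul1mx !mulmx0 !mul0mx !mulmx1 !addr0 mulmxN
               addrCA addNr addr0.
  by rewrite det_mulmx det_lblock det_ublock !det1 !mul1r.
rewrite mulrC -detK.
have <- : \det (block_mx S 0 (- U) (1%:M : 'M_p)) = \det S.
  by rewrite det_lblock det1 mulr1.
rewrite -det_mulmx mulmx_block !mul1mx !mulmx0 !mulmx1.
rewrite !mulmxN mulNmx opprK AU subrr !add0r.
exact: det_ublock.
Qed.

Lemma det_scalar_block2 (R : comPzRingType) (a b c d : R) :
  \det (block_mx a%:M b%:M c%:M d%:M : 'M_(1 + 1)) = a * d - b * c.
Proof.
rewrite (expand_det_row _ ord0) !big_ord_recl big_ord0 addr0.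
rewrite /cofactor !det_mx11 !mxE /=.
do !(case: splitP => -[[|?] //= ?] //= _; rewrite ?mxE /=) => //.
by rewrite expr0 expr1 !mulr1n; ring.
Qed.

(** The case A = X 1, S = X 1 of [det_rank_update], where every U qualifies. *)
Lemma char_poly_mulmxC (R : comNzRingType) p q (X : 'M[R]_(p, q)) (Y : 'M_(q, p)) :
  'X^q * char_poly (X *m Y) = 'X^p * char_poly (Y *m X).
Proof.
have := @det_rank_update _ p q 'X%:M 'X%:M (- map_mx polyC X) (map_mx polyC Y).
rewrite scalar_mxC mulNmx -map_mxM !det_scalar => -> //.
by rewrite mulrC mulmxN -map_mxM.
Qed.

(** The two constant blocks form a product UV, where the columns of U are the
    all-ones vectors of the two blocks.  Constant row sums make the span of these
    columns invariant under the diagonal part, so [det_rank_update] reduces the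
    effect of the coupling to a 2 x 2 determinant. *)
Lemma char_poly_block_const (R : comNzRingType) p q (A : 'M[R]_p) (B : 'M[R]_q)
    (a b s s' : R) :
    A *m const_mx 1 = const_mx a :> 'cV_p ->
    B *m const_mx 1 = const_mx b :> 'cV_q ->
  ('X - a%:P) * ('X - b%:P) * char_poly (block_mx A (const_mx s) (const_mx s') B)
  = (('X - a%:P) * ('X - b%:P) - (s * s' * p%:R * q%:R)%:P)
      * (char_poly A * char_poly B).
Proof.
move=> A1 B1.
have char1 n (M : 'M[R]_n) c : M *m const_mx 1 = const_mx c :> 'cV_n ->
    char_poly_mx M *m const_mx 1 = const_mx 1 *m ('X - c%:P)%:M :> 'cV_n.
  move=> M1; rewrite mul_mx_scalar mulmxBl mul_scalar_mx.
  have -> : const_mx 1 = map_mx polyC (const_mx (1 : R)) :> 'cV_n.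
    by rewrite map_const_mx.
  by rewrite -map_mxM M1 !map_const_mx; apply/matrixP=> i j; rewrite !mxE; ring.
pose U : 'M[{poly R}]_(p + q, 1 + 1) := block_mx (const_mx 1) 0 0 (const_mx 1).
pose V : 'M[{poly R}]_(1 + 1, p + q) :=
  block_mx 0 (const_mx (- s%:P)) (const_mx (- s'%:P)) 0.
pose S : 'M[{poly R}]_(1 + 1) :=
  block_mx ('X - a%:P)%:M 0%:M 0%:M ('X - b%:P)%:M.
pose D := block_mx (char_poly_mx A) 0 0 (char_poly_mx B).
have const_mul r m n (c d : {poly R}) : (const_mx c : 'M_(r, m)) *m const_mx d
    = const_mx (c * d *+ m) :> 'M_(r, n).
  apply/matrixP=> i j; rewrite !mxE; under eq_bigr do rewrite !mxE.
  by rewrite sumr_const card_ord.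
have DU : D *m U = U *m S.
  rewrite !mulmx_block !raddf0 ?mulmx0 !mul0mx !addr0 !add0r.
  by rewrite (char1 _ _ _ A1) (char1 _ _ _ B1).
have := det_rank_update V DU.
have -> : D + U *m V = char_poly_mx (block_mx A (const_mx s) (const_mx s') B).
  rewrite /char_poly_mx map_block_mx scalar_mx_block opp_block_mx !add_block_mx.
  rewrite mulmx_block add_block_mx !mulmx0 !mul0mx !addr0 !add0r.
  rewrite !const_mul !mul1r !map_const_mx.
  by congr block_mx; apply/matrixP=> i j; rewrite !mxE.
have -> : S + V *m U = block_mx ('X - a%:P)%:M (- s%:P *+ q)%:M (- s'%:P *+ p)%:M
    ('X - b%:P)%:M.
  rewrite mulmx_block add_block_mx !mulmx0 !mul0mx !addr0 !add0r.
  rewrite !const_mul !mulr1.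
  by congr block_mx; apply/matrixP=> i j; rewrite !mxE !ord1 ?mul0rn ?add0r.
rewrite /D !det_scalar_block2 det_ublock mulr0 subr0 /char_poly => ->.
congr (_ * _); rewrite !polyCM !polyC_natr.
by rewrite -[_ *+ q]mulr_natr -[_ *+ p]mulr_natr; ring.
Qed.

(** Substituting c X for X turns X - c A into c (X - A), and likewise each root
    factor X - c x into c (X - x). *)
Lemma char_polyZ (F : fieldType) n (c : F) (A : 'M[F]_n) (s : seq F) :
  c != 0 -> char_poly A = \prod_(x <- s) ('X - x%:P) ->
  char_poly (c *: A) = \prod_(x <- s) ('X - (c * x)%:P).
Proof.
move=> c0 charA.
have injX : injective (comp_poly (c *: 'X)).
  apply: (can_inj (g := comp_poly (c^-1 *: 'X))) => p.
  by rewrite -comp_polyA comp_polyZ comp_polyX scalerA divff // scale1r comp_polyXr.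
have size_s : size s = n.
  by apply: succn_inj; rewrite -(size_char_poly A) charA size_prod_XsubC.
apply: injX; rewrite rmorph_prod /char_poly -det_map_mx.
transitivity (\det (c%:P *: char_poly_mx A)).
  congr (\det _); apply/matrixP=> i j; rewrite !mxE rmorphB rmorphMn /=.
  by rewrite comp_polyX comp_polyC -mul_polyC polyCM; ring.
rewrite detZ [\det _]charA -size_s.
have -> : c%:P ^+ size s = \prod_(x <- s) c%:P.
  by rewrite big_const_seq count_predT iter_mulr_1.
rewrite -big_split /=.
apply: eq_bigr => x _; rewrite comp_polyB comp_polyX comp_polyC -mul_polyC polyCM.
by rewrite mulrBr.
Qed.
(** * The spectrum of a Cartesian product *)

Lemma sum_enum_val (R : nmodType) (T : finType) (F : T -> R) :
  \sum_(i < #|T|) F (enum_val i) = \sum_x F x.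
Proof. by rewrite -(big_enum_val F). Qed.

Lemma sum_eq_mulr (R : pzSemiRingType) (T : finType) (x : T) (F : T -> R) :
  \sum_y (x == y)%:R * F y = F x.
Proof.
rewrite (bigD1 x) //= eqxx mul1r big1 ?addr0 // => y.
by rewrite eq_sym => /negPf->; rewrite mul0r.
Qed.

Lemma sum_dist (R : pzSemiRingType) (G : digraph) (u : G) t :
  transmission_regular G t -> \sum_(v : G) (dist u v)%:R = t%:R :> R.
Proof. by case=> _ trG; rewrite -natr_sum [X in X%:R]trG. Qed.

Lemma dist_mx_ones (C : numClosedFieldType) (G : digraph) t :
  transmission_regular G t ->
  dist_mx G C *m const_mx 1 = const_mx t%:R :> 'cV_#|G|.
Proof.
move=> regG; apply/matrixP=> i j; rewrite !mxE.
under eq_bigr do rewrite !mxE mulr1.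
by rewrite (sum_enum_val (fun v => (dist (enum_val i) v)%:R)) (sum_dist _ _ regG).
Qed.

(** Kept as a polynomial identity with all cancelling factors on both sides, so
    that it can be read off as an equality of multisets of roots. *)
Lemma char_poly_cart_prod (C : numClosedFieldType) (G H : digraph) t t' :
  transmission_regular G t -> transmission_regular H t' ->
  let n := order_of G in let n' := order_of H in
  'X^(n + n') * (('X - (n' * t)%:R%:P) * ('X - (n * t')%:R%:P))
    * char_poly (dist_mx (cart_prod G H) C)
  = 'X^((n * n').+1) * ('X - (n' * t + n * t')%:R%:P)
    * (char_poly (n'%:R *: dist_mx G C) * char_poly (n%:R *: dist_mx H C)).
Proof.
move=> regG regH n n'; have [scG _] := regG; have [scH _] := regH.
(* [X1] and [X2] select the coordinates of a vertex of the product; [Y1] and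
   [Y2] are distances to its coordinates.  Additivity of the distance is the
   factorization [XY]. *)
pose X1 : 'M[C]_(#|cart_prod G H|, #|G|) :=
  \matrix_(k, i) ((enum_val k).1 == enum_val i)%:R.
pose X2 : 'M[C]_(#|cart_prod G H|, #|H|) :=
  \matrix_(k, i) ((enum_val k).2 == enum_val i)%:R.
pose Y1 : 'M[C]_(#|G|, #|cart_prod G H|) :=
  \matrix_(i, k) (dist (enum_val i) (enum_val k).1)%:R.
pose Y2 : 'M[C]_(#|H|, #|cart_prod G H|) :=
  \matrix_(i, k) (dist (enum_val i) (enum_val k).2)%:R.
have XY : row_mx X1 X2 *m col_mx Y1 Y2 = dist_mx (cart_prod G H) C.
  rewrite mul_row_col; apply/matrixP=> k k'; rewrite !mxE dist_cart_prod // natrD.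
  congr (_ + _); under eq_bigr do rewrite !mxE.
    by rewrite (sum_enum_val (fun x => (_ == x)%:R * (dist x _)%:R)) sum_eq_mulr.
  by rewrite (sum_enum_val (fun x => (_ == x)%:R * (dist x _)%:R)) sum_eq_mulr.
have sum_mul (f : G -> C) (g : H -> C) :
    \sum_(k < #|cart_prod G H|) f (enum_val k).1 * g (enum_val k).2
    = (\sum_x f x) * (\sum_y g y).
  rewrite (sum_enum_val (fun p : cart_prod G H => f p.1 * g p.2)).
  by rewrite -(pair_bigA _ (fun x y => f x * g y)) big_distrlr.
have sum_pick (T : finType) (F : T -> C) y : \sum_x F x * (x == y)%:R = F y.
  by rewrite -[RHS](sum_eq_mulr y); apply: eq_bigr => x _; rewrite mulrC eq_sym.
have sum_ind (T : finType) (y : T) : \sum_x (x == y)%:R = 1 :> C.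
  by rewrite -[RHS](sum_pick _ (fun=> 1) y); apply: eq_bigr => x _; rewrite mul1r.
have sum_one (T : finType) : \sum_(x : T) 1 = #|T|%:R :> C by rewrite sumr_const.
(* In the off-diagonal blocks the selected coordinate is not the one that the
   distance sees, so the sum over the product leaves a full row sum, which is the
   transmission. *)
have YX : col_mx Y1 Y2 *m row_mx X1 X2 =
    block_mx (n'%:R *: dist_mx G C) (const_mx t%:R)
             (const_mx t'%:R) (n%:R *: dist_mx H C).
  rewrite mul_col_row; congr block_mx; apply/matrixP=> i j; rewrite !mxE.
  - under eq_bigr do rewrite !mxE -[_ * _]mulr1.
    rewrite (sum_mul (fun x => (dist (enum_val i) x)%:R * (x == enum_val j)%:R)
                     (fun=> 1)).
    by rewrite sum_pick sum_one mulrC.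
  - under eq_bigr do rewrite !mxE.
    rewrite (sum_mul (fun x => (dist (enum_val i) x)%:R)
                     (fun y => (y == enum_val j)%:R)).
    by rewrite (sum_dist _ _ regG) sum_ind mulr1.
  - under eq_bigr do rewrite !mxE mulrC.
    rewrite (sum_mul (fun x => (x == enum_val j)%:R)
                     (fun y => (dist (enum_val i) y)%:R)).
    by rewrite (sum_dist _ _ regH) sum_ind mul1r.
  under eq_bigr do rewrite !mxE -[_ * _]mul1r.
  rewrite (sum_mul (fun=> 1)
             (fun y => (dist (enum_val i) y)%:R * (y == enum_val j)%:R)).
  by rewrite sum_pick sum_one.
have := char_poly_mulmxC (row_mx X1 X2) (col_mx Y1 Y2).
rewrite XY YX => charD.
have rowG : (n'%:R *: dist_mx G C) *m const_mx 1
    = const_mx (n' * t)%:R :> 'cV_#|G|.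
  rewrite -scalemxAl (dist_mx_ones C regG) natrM.
  by apply/matrixP=> i j; rewrite !mxE.
have rowH : (n%:R *: dist_mx H C) *m const_mx 1
    = const_mx (n * t')%:R :> 'cV_#|H|.
  rewrite -scalemxAl (dist_mx_ones C regH) natrM.
  by apply/matrixP=> i j; rewrite !mxE.
(* As n' t * n t' = t * t' * n * n', the 2 x 2 determinant loses its constant term
   and becomes X (X - (n' t + n t')). *)
have := char_poly_block_const t%:R t'%:R rowG rowH.
set P := char_poly (block_mx _ _ _ _) in charD *.
set L := ('X - _) * _; rewrite -[#|G|]/n -[#|H|]/n' => blockE.
have cardGH : #|cart_prod G H| = (n * n')%N := order_cart_prod G H.
rewrite mulrAC charD -[LHS]mulrA (mulrC P) blockE cardGH exprS.
by rewrite /L !polyCM !polyC_natr !natrD !natrM; ring.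
Qed.

(** The row-sum eigenvalues n' t and n t' of the two factors, which occur on the
    right inside the scaled spectra, are traded for n' t + n t' and 0.  Listing
    them on the left expresses their removal without subtracting multisets; the
    extra zeros on the two sides account for the sizes n + n' and n n'. *)
Lemma spec_cart_prod (C : numClosedFieldType) (G H : digraph) (t t' : nat)
    (n := order_of G) (n' := order_of H) :
    transmission_regular G t -> transmission_regular H t' ->
  perm_eq
    (nseq (n + n') 0 ++ (n' * t)%:R :: (n * t')%:R
       :: spec (dist_mx (cart_prod G H) C))
    (nseq (n * n').+1 0 ++ (n' * t + n * t')%:R
       :: [seq n'%:R * x | x <- spec (dist_mx G C)]
       ++ [seq n%:R * x | x <- spec (dist_mx H C)]).
Proof.
move=> regG regH; apply: prod_XsubC_eq.
have prod0 k : \prod_(x <- nseq k 0) ('X - x%:P) = 'X^k :> {poly C}.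
  by rewrite big_nseq subr0 iter_mulr_1.
have [[ltG _] _] := regG; have [[ltH _] _] := regH.
rewrite !big_cat !prod0 !big_cons !big_cat !big_map.
rewrite -(char_polyZ _ (char_poly_spec (dist_mx G C))); last first.
  by rewrite Num.Theory.pnatr_eq0 -lt0n; apply: ltnW.
rewrite -(char_polyZ _ (char_poly_spec (dist_mx H C))); last first.
  by rewrite Num.Theory.pnatr_eq0 -lt0n; apply: ltnW.
by have := char_poly_cart_prod C regG regH; rewrite char_poly_spec /= !mulrA.
Qed.

Lemma size_spec (C : numClosedFieldType) n (A : 'M[C]_n) : size (spec A) = n.
Proof.
by apply: succn_inj; rewrite -(size_char_poly A) char_poly_spec size_prod_XsubC.
Qed.

Unset Implicit Arguments.

Theorem proposition5p4 (C : numClosedFieldType) (G : digraph)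
    (n t m : nat) (d2 : C) (l : nat)
    (hn : order_of G = n)
    (ht : transmission_regular G t)
    (hspec : perm_eq (spec (dist_mx G C))
               (t%:R :: nseq m d2 ++ nseq (n - 1 - m)%N 0))
    (hl : (0 < l)%N) :
  [/\ strongly_connected (cart_power G l),
      order_of (cart_power G l) = (n ^ l)%N &
      perm_eq (spec (dist_mx (cart_power G l) C))
        ((l * t * n ^ (l - 1))%N%:R
           :: nseq (m * l)%N (d2 * (n ^ (l - 1))%N%:R)
           ++ nseq (n ^ l - 1 - m * l)%N 0)].
Proof.
(* The induction needs the transmission of the power, beyond its connectivity. *)
suff [regGl ? ?] :
  [/\ transmission_regular (cart_power G l) (l * t * n ^ (l - 1)),
      order_of (cart_power G l) = (n ^ l)%N &
      perm_eq (spec (dist_mx (cart_power G l) C))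
        ((l * t * n ^ (l - 1))%N%:R
           :: nseq (m * l)%N (d2 * (n ^ (l - 1))%N%:R)
           ++ nseq (n ^ l - 1 - m * l)%N 0)].
  by case: regGl.
case: l hl => // l _; elim: l => [|l IHl].
  by rewrite !subSS !expn1 expn0 !mul1n !muln1 mulr1.
have [reg_l order_l spec_l] := IHl.
set H := cart_power G l.+1 in reg_l order_l spec_l.
have -> : cart_power G l.+2 = cart_prod G H by [].
set N := (n ^ l.+1)%N in order_l spec_l *.
have nN : (n ^ l.+2)%N = (n * N)%N by rewrite expnS.
have order_GH : order_of (cart_prod G H) = (n * N)%N.
  by rewrite order_cart_prod hn order_l.
rewrite subSS subn0 in reg_l spec_l.
have trans_GH : (order_of H * t + order_of G * (l.+1 * t * n ^ l))%N
    = (l.+2 * t * N)%N.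
  by rewrite order_l hn /N expnS; lia.
rewrite nN; split=> //.
  by rewrite -trans_GH; apply: transmission_regular_cart_prod.
have specGH := spec_cart_prod C ht reg_l.
rewrite trans_GH order_l hn in specGH.
(* The lengths of the listed spectra are the orders, so the subtractions below
   never truncate. *)
have m_lt : (m < n)%N.
  have := perm_size hspec; rewrite size_spec -[#|G|]/(order_of G) hn /= size_cat.
  by rewrite !size_nseq; lia.
have ml_lt : (m * l.+1 < N)%N.
  have := perm_size spec_l; rewrite size_spec -[#|H|]/(order_of H) order_l.
  by rewrite /= size_cat !size_nseq; lia.
apply/permP=> P; move/permP: specGH => /(_ P).
move/(perm_map (fun x => N%:R * x))/permP: hspec => /(_ P).
move/(perm_map (fun x => n%:R * x))/permP: spec_l => /(_ P).
rewrite /= !count_cat /= !map_cat !count_cat !map_nseq !count_nseq !mulr0.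
rewrite -!natrM.
have -> : n%:R * (d2 * (n ^ l)%:R) = d2 * N%:R by rewrite mulrCA -natrM /N expnS.
have -> : (n * (l.+1 * t * n ^ l) = l.+1 * t * N)%N by rewrite /N expnS; lia.
rewrite (mulrC N%:R d2) => -> ->.
(* The number of zeros; that n + N <= 1 + n * N is (n - 1) * (N - 1) >= 0. *)
have zeros : ((n * N - 1 - m * l.+2) + (n + N)
    = 1 + n * N + (n - 1 - m) + (N - 1 - m * l.+1))%N.
  have le_nN : (n + N <= 1 + n * N)%N by nia.
  by rewrite !mulnS in ml_lt *; lia.
rewrite !mulnS in zeros ml_lt *.
by case: (P 0); case: (P (d2 * N%:R)); rewrite ?mul1n ?mul0n; lia.
Qed.
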